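(* Let $A$ be a semiprime Novikov algebra. Then every ideal $I$ of $A$, regarded as an algebra in its own right, is a semiprime Novikov algebra.
   Context: Algebras are (not necessarily associative, not necessarily unital) algebras over a field. Write $(a,b,c)=(ab)c-a(bc)$. A Novikov algebra is an algebra satisfying the identities $(a,b,c)=(b,a,c)$ and $(ab)c=(ac)b$. ''Ideal'' means two-sided ideal. For subspaces $U,V$, the product $UV$ is the linear span of all $uv$, $u\in U$, $v\in V$, and $U^2=UU$. An algebra $A$ is semiprime if for any ideal $I$ of $A$, $I^2=0$ implies $I=0$. *)

(* Defs.v *)
(* Subspaces and ideals are Prop-valued sets, so that no decidability of
   membership is required; the (axiomatic) boolean membership x \in U of
   classical_sets gives access to the linear subspaces of ssralg. *)
From HB Require Import structures.
From mathcomp Require Import all_boot all_order all_algebra.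
From mathcomp Require Import mathcomp_extra boolp classical_sets.

Set Implicit Arguments.
Unset Strict Implicit.
Unset Printing Implicit Defensive.

Import GRing.Theory.
Local Open Scope classical_set_scope.
Local Open Scope ring_scope.

(* Neither associativity, nor a unit, nor finite dimension is assumed. *)
Record algebra (F : fieldType) := Algebra {
  algebra_sort :> lmodType F;
  algebra_mul : {bilinear algebra_sort -> algebra_sort -> algebra_sort}
}.

Notation "x ** y" := (algebra_mul _ x y) (at level 40, left associativity).

Section Notions.
Variables (F : fieldType) (A : algebra F).

Definition associator (a b c : A) : A := (a ** b) ** c - a ** (b ** c).

Definition novikov : Prop :=
  (forall a b c : A, associator a b c = associator b a c) /\
  (forall a b c : A, (a ** b) ** c = (a ** c) ** b).

Definition is_subspace (U : set A) : Prop := submod_closed (fun x => x \in U).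

Definition span (X : set A) : set A := smallest is_subspace X.

Definition set_prod (U V : set A) : set A :=
  span [set u ** v | u in U & v in V].

Definition is_ideal (I : set A) : Prop :=
  is_subspace I /\ forall a x : A, I x -> I (a ** x) /\ I (x ** a).

Definition semiprime : Prop :=
  forall I : set A, is_ideal I -> set_prod I I = [set 0] -> I = [set 0].

End Notions.

Section IdealAlgebra.
Variables (F : fieldType) (A : algebra F).

Record ideal := Ideal { ideal_set :> set A; idealP : is_ideal ideal_set }.

Variable I : ideal.

Definition ideal_pred : {pred A} := fun x => x \in (I : set A).

Fact ideal_pred_submod : submod_closed ideal_pred.
Proof. by case: (idealP I). Qed.

HB.instance Definition _ := GRing.isSubmodClosed.Build F A ideal_pred
  (GRing.submod_closed_semi ideal_pred_submod).

Definition ideal_sort := {x : A | x \in ideal_pred}.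
HB.instance Definition _ := SubChoice.on ideal_sort.
HB.instance Definition _ := [SubChoice_isSubLmodule of ideal_sort by <:].

Fact ideal_mul_subproof (x y : ideal_sort) : val x ** val y \in ideal_pred.
Proof.
have [_ h] := idealP I.
by apply: mem_set; apply: (h _ _ (set_mem (valP y))).1.
Qed.

Definition ideal_mul (x y : ideal_sort) : ideal_sort :=
  Sub (val x ** val y) (ideal_mul_subproof x y).

Fact ideal_mul_bilinear :
  bilinear_for ( *:%R : F -> ideal_sort -> ideal_sort)
               ( *:%R : F -> ideal_sort -> ideal_sort) ideal_mul.
Proof.
split=> u a x y; apply: val_inj; rewrite /=.
  by rewrite linearPl.
by rewrite linearPr.
Qed.

HB.instance Definition _ := bilinear_isBilinear.Build F
  ideal_sort ideal_sort ideal_sort *:%R *:%R ideal_mul ideal_mul_bilinear.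

Definition ideal_algebra : algebra F := @Algebra F ideal_sort ideal_mul.

End IdealAlgebra.

(* Main.v *)
(** Let J be an ideal of I with J^2 = 0.  An element x of I with xI = 0 is
zero, since such elements form an ideal of A with square zero.

Suppose first that moreover JA is contained in J.  Then
Z = {x in I | xJ = Jx = 0} is an ideal of A: for x in Z, the elements s = (ax)j
satisfy us = -su for all u in I, whence b(su) = -(sb)u for all b in A, so the
elements su span an ideal of A with square zero, and therefore s = 0.  Since J
is contained in Z and JZ = 0, we get J = 0.

In general, IJ is stable under right multiplication by A, because
(uj)a = (ua)j; hence IJ = 0.  Then (AJ)I = (AI)J = 0, so AJ = 0, and a(ju) = 0
yields (ju)a = j(au).  Thus JI spans an ideal of A with square zero, JI = 0 and
J = 0. *)
From mathcomp Require Import all_boot all_algebra.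
From mathcomp Require Import boolp classical_sets.
Require Import Defs.

Set Implicit Arguments.
Unset Strict Implicit.
Unset Printing Implicit Defensive.

Import GRing.Theory.
Local Open Scope classical_set_scope.
Local Open Scope ring_scope.

Section Subspaces.
Variables (F : fieldType) (A : algebra F).
Implicit Types (U X : set A) (x y : A).

(** Trades the boolean membership of [submod_closed] for Prop-valued membership in [U]. *)
Lemma is_subspaceP U :
  is_subspace U <->
  U 0 /\ forall (k : F) x y, U x -> U y -> U (k *: x + y).
Proof.
split=> [[U0 UP]|[U0 UP]]; split.
- exact: set_mem U0.
- move=> k x y Ux Uy; apply: set_mem.
  by apply: UP; rewrite unfold_in; apply: mem_set.
- exact: mem_set.
- move=> k x y; rewrite !unfold_in => /set_mem Ux /set_mem Uy.
  by apply: mem_set; apply: UP.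
Qed.

Lemma subspaceN U x : is_subspace U -> U x -> U (- x).
Proof.
move=> /is_subspaceP[U0 UP] Ux.
by rewrite -scaleN1r -[_ *: _]addr0; apply: UP.
Qed.

Lemma span_subspace X : is_subspace (span X).
Proof.
apply/is_subspaceP; split=> [V [/is_subspaceP[V0 _] _] //|k x y Xx Xy V VP].
have [/is_subspaceP[_ VS] _] := VP.
by apply: VS; [apply: Xx | apply: Xy].
Qed.

Lemma mem_span X x : X x -> span X x.
Proof. by move=> Xx V [_]; apply. Qed.

Lemma span_sub X U : is_subspace U -> X `<=` U -> span X `<=` U.
Proof. by move=> sU XU x; apply. Qed.

End Subspaces.

Section Semiprime.
Variables (F : fieldType) (A : algebra F).
Hypothesis spA : semiprime A.
Implicit Types (I G : set A).

Lemma semiprime_sq0 I :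
  is_ideal I -> (forall x y, I x -> I y -> x ** y = 0) ->
  forall x, I x -> x = 0.
Proof.
move=> idI I2 x Ix; suff I0 : I = [set 0] by move: Ix; rewrite I0.
apply: spA => //; apply/seteqP; split.
  apply: span_sub => [|_ [y Iy] [z Iz] <-]; last exact: I2.
  by apply/is_subspaceP; split=> // k y z -> ->; rewrite scaler0 addr0.
by move=> _ ->; have /is_subspaceP[] := span_subspace [set u ** v | u in I & v in I].
Qed.

(** By bilinearity, conditions on generators make [span G] an ideal of square zero, so [G] may be a
    bare set of products. *)
Lemma semiprime_gen0 G :
  (forall g a, G g -> span G (g ** a)) ->
  (forall g a, G g -> span G (a ** g)) ->
  (forall g h, G g -> G h -> g ** h = 0) ->
  forall g, G g -> g = 0.
Proof.
move=> Gr Gl G2 g /mem_span; apply: semiprime_sq0 => [|x y Gx Gy].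
  have /is_subspaceP[s0 sP] := span_subspace G.
  split=> [|a x Gx]; first exact: span_subspace.
  pose V := [set y : A | span G (a ** y) /\ span G (y ** a)].
  suff sV : is_subspace V.
    by apply: (span_sub sV _ Gx) => h Gh; split; [apply: Gl | apply: Gr].
  apply/is_subspaceP; split=> [|k u v [u1 u2] [v1 v2]]; split.
  - by rewrite linear0r.
  - by rewrite linear0l.
  - by rewrite linearPr; apply: sP.
  - by rewrite linearPl; apply: sP.
have {}G2 h : G h -> x ** h = 0.
  move=> Gh; pose V := [set y : A | y ** h = 0].
  apply: (span_sub (U := V) _ _ Gx) => [|h' Gh']; last exact: G2.
  apply/is_subspaceP; split=> [|k u v u0 v0]; first exact: linear0l.
  by rewrite /V /= linearPl u0 v0 scaler0 addr0.
pose V := [set y : A | x ** y = 0].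
apply: (span_sub (U := V) _ _ Gy) => //.
apply/is_subspaceP; split=> [|k u v u0 v0]; first exact: linear0r.
by rewrite /V /= linearPr u0 v0 scaler0 addr0.
Qed.

End Semiprime.

Section Novikov.
Variables (F : fieldType) (A : algebra F).
Hypothesis novA : novikov A.
Implicit Types (I J : set A) (a b c x : A).

Lemma novikovAC a b c : (a ** b) ** c = (a ** c) ** b.
Proof. by case: novA. Qed.

(** Left symmetry solved for [a ** (b ** c)], for use as a rewriting rule. *)
Lemma novikovCA a b c :
  a ** (b ** c) = (a ** b) ** c + (b ** (a ** c) - (b ** a) ** c).
Proof.
have [/(_ a b c) + _] := novA; rewrite /associator => h.
by rewrite -[b ** _ - _]opprB -h opprB addrC subrK.
Qed.

Hypothesis spA : semiprime A.

Lemma semiprime_lann0 I x :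
  is_ideal I -> I x -> (forall u, I u -> x ** u = 0) -> x = 0.
Proof.
move=> [sI idI] Ix xI.
pose K := [set y : A | I y /\ forall u, I u -> y ** u = 0].
apply: (semiprime_sq0 spA (I := K)) => // [|y z [_ yI] [Iz _]]; last exact: yI.
have /is_subspaceP[I0 IP] := sI.
split=> [|a y [Iy yI]].
  apply/is_subspaceP; split=> [|k y z [Iy yI] [Iz zI]]; split=> //.
  - by move=> u _; exact: linear0l.
  - exact: IP.
  - by move=> u Iu; rewrite linearPl yI // zI // scaler0 addr0.
have yaI u : I u -> (y ** a) ** u = 0.
  by move=> Iu; rewrite novikovAC yI // linear0l.
have [Iay Iya] := idI a y Iy.
split; split=> // u Iu.
have := novikovCA a y u; rewrite yI // linear0r yaI // subr0.
by rewrite (yI _ (idI a u Iu).1) addr0 => <-.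
Qed.

Section SquareZero.
Variables (I J : set A).
Hypothesis idI : is_ideal I.
Hypotheses (JI : J `<=` I) (J2 : forall j k, J j -> J k -> j ** k = 0).
Hypotheses (IJ : forall u j, I u -> J j -> J (u ** j)).
Hypotheses (Jr : forall j a, J j -> J (j ** a)).

Let Z := [set x : A | I x /\ forall j, J j -> x ** j = 0 /\ j ** x = 0].

Lemma lmul_mul0 a x j : Z x -> J j -> (a ** x) ** j = 0.
Proof.
move: (idI) => [sI mI] [Ix xJ] Jj.
(* Left symmetry for [k], [b], [x]: here [(k ** b) ** x] and [k ** x] vanish, since [k ** b] and [k]
   lie in [J]. *)
have swap b k : J k -> (b ** x) ** k = - (k ** (b ** x)).
  move=> Jk; rewrite novikovCA (xJ _ (Jr b Jk)).2 (xJ _ Jk).2 linear0r.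
  by rewrite !add0r opprK novikovAC.
(* The terms [(u ** k) ** (b ** x)] and [(b ** x) ** (u ** k)] cancel by [swap], as [u ** k] is in
   [J]. *)
have anti b k u : J k -> I u ->
    u ** ((b ** x) ** k) = - (((b ** x) ** k) ** u).
  move=> Jk Iu; rewrite novikovCA (novikovAC u) addrA.
  by rewrite (swap _ _ (IJ Iu Jk)) subrr add0r novikovAC.
have mulr b k c : ((b ** x) ** k) ** c = ((b ** c) ** x) ** k.
  by rewrite novikovAC (novikovAC b).
have JS b k : J k -> J ((b ** x) ** k).
  by move=> Jk; rewrite swap // -linearNr; apply: Jr.
have sI0 u : I u -> ((a ** x) ** j) ** u = 0.
  move=> Iu.
  (* Here [b] ranges over [A] because right multiplication by [c] turns it into [b ** c]. *)
  pose G := [set z : A | exists b k v,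
    [/\ J k, I v & z = ((b ** x) ** k) ** v]].
  have Gs b k v : J k -> I v -> G (((b ** x) ** k) ** v).
    by move=> Jk Iv; exists b, k, v.
  apply: (semiprime_gen0 spA (G := G)); last exact: Gs.
  - move=> _ c [b [k [v [Jk Iv ->]]]]; apply: mem_span.
    by rewrite novikovAC mulr; apply: Gs.
  - move=> _ c [b [k [v [Jk Iv ->]]]].
    (* For [s = (b ** x) ** k], the term [(c ** s) ** v = (c ** v) ** s] cancels [s ** (c ** v)] by
       [anti], leaving [- ((s ** c) ** v)]. *)
    rewrite novikovCA (novikovAC c) (anti b k _ Jk (mI c v Iv).1).
    rewrite addrA addNr add0r mulr.
    exact: (subspaceN (span_subspace G) (mem_span (Gs _ _ _ Jk Iv))).
  - move=> _ _ [b [k [v [Jk Iv ->]]]] [c [l [w [Jl Iw ->]]]].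
    by apply: J2; apply/Jr/JS.
apply: (semiprime_lann0 idI _ sI0); apply/JI/JS/Jj.
Qed.

Lemma right_stable_sq0_eq0 j : J j -> j = 0.
Proof.
move: (idI) => [sI mI] Jj.
have JZ k : J k -> Z k by move=> Jk; split=> [|l Jl]; [apply: JI | rewrite !J2].
have idZ : is_ideal Z.
  have /is_subspaceP[I0 IP] := sI.
  split=> [|a x Zx].
    apply/is_subspaceP; split=> [|k x y [Ix xJ] [Iy yJ]].
      by split=> // l Jl; rewrite linear0l linear0r.
    split=> [|l Jl]; first exact: IP.
    rewrite linearPl linearPr (xJ _ Jl).1 (xJ _ Jl).2 (yJ _ Jl).1 (yJ _ Jl).2.
    by rewrite scaler0 addr0.
  have [Ix xJ] := Zx; have [Iax Ixa] := mI a x Ix.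
  split; split=> // l Jl; have [xl lx] := xJ l Jl; split.
  - exact: lmul_mul0.
  - rewrite novikovCA lx linear0r (xJ _ (Jr a Jl)).2 (novikovAC a).
    by rewrite lmul_mul0 // subrr addr0.
  - by rewrite novikovAC xl linear0l.
  - rewrite novikovCA lx xl !linear0l (xJ _ (Jr a Jl)).1.
    by rewrite subrr addr0.
(* The annihilator lemma is applied to the ideal [Z]: [j] lies in [Z] and [j ** x = 0] for all [x]
   in [Z]. *)
by apply: (semiprime_lann0 idZ (JZ _ Jj)) => x [_ /(_ j Jj)[]].
Qed.

End SquareZero.

Lemma ideal_of_ideal_sq0 I J : is_ideal I -> J `<=` I ->
  (forall u j, I u -> J j -> J (u ** j) /\ J (j ** u)) ->
  (forall j k, J j -> J k -> j ** k = 0) ->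
  forall j, J j -> j = 0.
Proof.
move=> idI JI JP J2 j Jj; have [sI mI] := idI.
have IJ0 u k : I u -> J k -> u ** k = 0.
  (* Right multiplication by [A] preserves [X], which is not known of [J]. *)
  move=> Iu Jk; pose X := [set v ** l | v in I & l in J].
  have XJ : X `<=` J by move=> _ [v Iv [l Jl <-]]; apply: (JP _ _ Iv Jl).1.
  apply: (right_stable_sq0_eq0 (J := X) idI); last by exists u => //; exists k.
  - by move=> x /XJ/JI.
  - by move=> x y /XJ Jx /XJ; apply: J2.
  - by move=> v x Iv /XJ Jx; exists v => //; exists x.
  - move=> _ a [v Iv [l Jl <-]]; exists (v ** a); first exact: (mI _ _ Iv).2.
    by exists l => //; rewrite novikovAC.
have AJ0 a k : J k -> a ** k = 0.
  move=> Jk; apply: (semiprime_lann0 idI) => [|u Iu].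
    exact: (mI _ _ (JI _ Jk)).1.
  by rewrite novikovAC IJ0 //; apply: (mI _ _ Iu).1.
apply: (semiprime_lann0 idI (JI _ Jj)) => u Iu.
pose X := [set k ** v | k in J & v in I].
have XJ : X `<=` J by move=> _ [l Jl [v Iv <-]]; apply: (JP _ _ Iv Jl).2.
apply: (semiprime_gen0 spA (G := X)); last by exists j => //; exists u.
- move=> _ a [l Jl [v Iv <-]]; apply: mem_span.
  exists l => //; exists (a ** v); first exact: (mI _ _ Iv).1.
  (* Both [a ** (l ** v)] and [a ** l] vanish by [AJ0], so left symmetry reads
     [l ** (a ** v) = (l ** a) ** v]. *)
  have := novikovCA a l v.
  rewrite (AJ0 _ _ (JP _ _ Iv Jl).2) (AJ0 _ _ Jl) linear0l add0r.
  by move/esym/subr0_eq => ->; rewrite novikovAC.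
- move=> x a /XJ /AJ0 ->.
  by have /is_subspaceP[] := span_subspace X.
- by move=> x y _ /XJ /AJ0.
Qed.

End Novikov.

Theorem theorem2 (F : fieldType) (A : algebra F) :
  novikov A -> semiprime A ->
  forall I : ideal A, novikov (ideal_algebra I) /\ semiprime (ideal_algebra I).
Proof.
move=> novA spA I; split.
  (* Both identities pass to [I] because [val] is injective and multiplicative. *)
  have [lsym rcom] := novA.
  split=> a b c; apply: val_inj; last exact: rcom.
  exact: (lsym (val a) (val b) (val c)).
move=> J [sJ mJ] J2.
have JJ0 x y : J x -> J y -> x ** y = 0.
  move=> Jx Jy; suff : [set 0] (x ** y) by [].
  by rewrite -J2; apply: mem_span; exists x => //; exists y.
apply/seteqP; split=> [x Jx|_ ->]; last by have /is_subspaceP[] := sJ.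
suff x0 : val x = 0 by exact: val_inj.
(* The image of [J] in [A] is known to be stable only under multiplication by elements of [I]. *)
apply: (ideal_of_ideal_sq0 novA spA (idealP I) (J := [set val y | y in J]));
  last by exists x.
- by move=> _ [y _ <-]; apply: set_mem (valP y).
- move=> u _ Iu [y Jy <-].
  pose u' : ideal_algebra I := Sub u (mem_set Iu).
  by have [] := mJ u' y Jy; split; [exists (u' ** y) | exists (y ** u')].
- move=> _ _ [y Jy <-] [z Jz <-].
  by have /(congr1 val) := JJ0 _ _ Jy Jz.
Qed.
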